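(* Let $G$ be a connected claw-free cubic graph with $G\not\cong K_4$, let $T$ be the number of triangle units and $D$ the number of diamond units of $G$, and let $M_{G'}$ be the contraction multigraph of $G$. If $M_{G'}$ is Hamiltonian, then $Z(G)\le \frac{T}{2}+D+2$.
   Context: $G$ is a finite simple graph. A graph is cubic if it is $3$-regular, and claw-free if it has no induced subgraph isomorphic to $K_{1,3}$. Zero forcing: start with a set $S\subseteq V(G)$ of colored vertices, all other vertices being uncolored. A colored vertex $v$ forces an uncolored neighbor $u$ to become colored if $u$ is the only uncolored neighbor of $v$. If iterating this rule colors all of $V(G)$, then $S$ is a zero forcing set. The zero forcing number $Z(G)$ is the minimum cardinality of a zero forcing set of $G$. Units: the vertex set of a connected claw-free cubic graph $G\not\cong K_4$ can be uniquely partitioned into sets each inducing either a triangle $K_3$ (a triangle unit) or a diamond, i.e. $K_4$ minus one edge (a diamond unit). $T$ and $D$ are the numbers of triangle units and diamond units in this partition. Contraction multigraph: each diamond unit has exactly two vertices (the ends of its missing edge) with a neighbor outside the unit, each with exactly one such neighbor. If $T\ge 1$, every maximal sequence of consecutively linked diamond units $D_1,\dots,D_m$ ($m\ge1$, consecutive ones joined by an edge of $G$) is attached at its two ends to vertices $x$ and $y$ lying in triangle units. If $x,y$ lie in different triangle units, the sequence is part of a diamond chain; if $x,y$ are two vertices of the same triangle unit, it is part of a diamond bracelet. The (multi)graph $G'$ is obtained from $G$ by deleting the diamond units of every such sequence and adding an edge $xy$ in their place. The multigraph $M_{G'}$ is obtained from $G'$ by contracting every triangle unit to a single vertex (the three edges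 of the triangle unit disappear; every other edge of $G'$ is kept, so parallel edges may occur, and an edge added for a diamond bracelet becomes a loop). Thus $M_{G'}$ is a cubic multigraph with $T$ vertices. It is Hamiltonian if it has a cycle through all of its vertices, where two parallel edges count as a cycle on two vertices. If $T=0$, then $G$ is a diamond necklace (its diamond units are linked cyclically), and this case is regarded as included, i.e. $M_{G'}$ is regarded as Hamiltonian. *)

(* Defs.v *)
From mathcomp Require Import all_boot.
Set Implicit Arguments.
Unset Strict Implicit.
Unset Printing Implicit Defensive.

Definition connected_graph (V : finType) (e : rel V) : Prop :=
  0 < #|V| /\ forall x y : V, connect e x y.

Definition cubic (V : finType) (e : rel V) : Prop :=
  forall x : V, #|[set y | e x y]| = 3.

(* The subgraph of (V, e) induced by A is isomorphic to (U, h). *)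
Definition induces (V U : finType) (e : rel V) (h : rel U) (A : {set V}) : bool :=
  [exists f : {ffun U -> V},
    [&& injectiveb f, [set f i | i : U] == A
      & [forall i, forall j, e (f i) (f j) == h i j]]].

Definition complete_graph (n : nat) : rel 'I_n := fun i j => i != j.
Arguments complete_graph n : clear implicits.

(* K_{1,3}, with center 0. *)
Definition claw : rel 'I_4 := fun i j => (i == ord0) != (j == ord0).

(* K_4 minus the edge {0, 3}. *)
Definition diamond : rel 'I_4 :=
  fun i j => (i != j) && ([set i; j] != [set ord0; ord_max]).

Definition claw_free (V : finType) (e : rel V) : Prop :=
  forall A : {set V}, ~~ induces e claw A.

Section ZeroForcing.
Variables (V : finType) (e : rel V).
Implicit Types (S : {set V}) (v u : V).

Definition forces S v u : bool :=
  [&& v \in S, u \notin S, e v u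
    & [forall w, (e v w && (w \notin S)) ==> (w == u)]].

Definition force_step : rel {set V} := fun S S' =>
  [exists v, exists u, forces S v u && (S' == u |: S)].

Definition zero_forcing S : bool := connect force_step S [set: V].

(* The whole vertex set is zero forcing, so this is a minimum over a nonempty
   family. *)
Definition zero_forcing_number : nat :=
  #|[arg min_(S < [set: V] | zero_forcing S) #|S| ]|.
End ZeroForcing.

(* A loop is an edge whose set of ends is a singleton. *)
Record multigraph (X E : finType) := Multigraph {
  mverts : {set X};
  medges : {set E};
  mends : E -> {set X}
}.

Section Multigraphs.
Variables (X E : finType).
Implicit Type M : multigraph X E.

(* The cycle vs`_0 -es`_0- vs`_1 -es`_1- ... -es`_(n-1)- vs`_0.  As its edges
   are distinct, a cycle on two vertices consists of two parallel edges. *)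
Definition hamiltonian M : Prop :=
  exists (vs : seq X) (es : seq E),
    [/\ 1 < size vs, uniq vs & [set:: vs] = mverts M] /\
    [/\ uniq es, {subset es <= medges M}
      & [seq mends M f | f <- es] = [seq [set p.1; p.2] | p <- zip vs (rot 1 vs)]].

(* Delete the edges in F, then identify the vertices in each block of Q. *)
Definition contract M (Q : {set {set X}}) (F : {set E}) : multigraph {set X} E :=
  {| mverts := Q;
     medges := medges M :\: F;
     mends := fun f => [set pblock Q x | x in mends M f] |}.
End Multigraphs.

Section Units.
Variables (V : finType) (e : rel V).

Definition triangle_unit (A : {set V}) : bool := induces e (complete_graph 3) A.
Definition diamond_unit (A : {set V}) : bool := induces e diamond A.

Definition unit_partition (P : {set {set V}}) : bool :=
  partition P [set: V] && [forall A in P, triangle_unit A || diamond_unit A].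

Variable P : {set {set V}}.

Definition triangle_units : {set {set V}} := [set A in P | triangle_unit A].
Definition diamond_units : {set {set V}} := [set A in P | diamond_unit A].

Definition linked : rel {set V} := fun A B =>
  [exists a in A, exists b in B, e a b].

Definition linked_seq (s : seq {set V}) : bool :=
  [&& s != [::], all (mem diamond_units) s, uniq s & sorted linked s].

Definition maximal_linked_seq (s : seq {set V}) : bool :=
  linked_seq s &&
  [forall B, ~~ linked_seq (B :: s) && ~~ linked_seq (rcons s B)].

Definition attached (s : seq {set V}) (x y : V) : bool :=
  [&& x != y, [exists a in head set0 s, e x a]
    & [exists b in last set0 s, e b y]].

(* An edge of G' is the pair of its set of two ends and of the set of diamond
   units that it replaces, which is empty for an edge of G. *)
Local Notation Gprime_edge := ({set V} * {set {set V}})%type.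

Definition kept_edges : {set Gprime_edge} :=
  [set f : Gprime_edge | (f.2 == set0) &&
    [exists x in cover triangle_units, exists y in cover triangle_units,
      e x y && (f.1 == [set x; y])]].

Definition added_edges : {set Gprime_edge} :=
  [set f : Gprime_edge | [exists x in cover triangle_units, exists y in cover triangle_units,
    (f.1 == [set x; y]) &&
    has (fun s => maximal_linked_seq s && attached s x y)
        (permutations (enum f.2))]].

Definition Gprime : multigraph V Gprime_edge :=
  {| mverts := cover triangle_units;
     medges := kept_edges :|: added_edges;
     mends := fun f => f.1 |}.

Definition triangle_edges : {set Gprime_edge} :=
  [set f in kept_edges | [exists A in triangle_units, f.1 \subset A]].

Definition contraction_multigraph : multigraph {set V} Gprime_edge :=
  contract Gprime triangle_units triangle_edges.

(* Without triangle units, the graph is a diamond necklace and its contraction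
   multigraph is by convention Hamiltonian. *)
Definition contraction_hamiltonian : Prop :=
  triangle_units = set0 \/ hamiltonian contraction_multigraph.
End Units.

(* Main.v *)
Require Import Defs.
From mathcomp Require Import all_boot all_order all_algebra lra.

(** Color one non-port ("middle") vertex of each diamond unit.  Once both ends
    of an edge leaving a unit are colored, the color then runs through any
    sequence of diamond units that the edge leads to.  Number the triangles
    t_0, ..., t_(n-1) along the Hamiltonian cycle; t_i has a port on each of the
    two cycle edges at t_i and a third port z_i.  When t_(i-1) is colored, so is
    the entry port of t_i, hence all of t_i as soon as z_i is colored.  The
    diamond sequences pair off the z_i, and it suffices to color the z_i of
    smaller index in each pair: the other one is reached from an earlier
    triangle.  Two more vertices color t_0 entirely.

    Instead of tracing the sequences out of the z_i, we use two involutions: one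
    sends a vertex to its neighbor in another unit, the other one swaps the two
    ports of a diamond.  A parity count on their common orbits gives the
    pairing. *)
Set Implicit Arguments.
Unset Strict Implicit.
Unset Printing Implicit Defensive.

(** * Stalled sets *)

Section Stalled.
Variables (V : finType) (e : rel V).
Implicit Types (C S : {set V}).

(** Stalled sets are where a forcing process ends. Working with them turns forcing into a closure
    argument, with no explicit order of forces. *)
Definition stalled C : Prop := forall v u, ~~ forces e C v u.

Lemma stalled_force C v u :
    stalled C -> v \in C -> e v u ->
    (forall w, e v w -> w != u -> w \in C) ->
  u \in C.
Proof.
move=> stC vC evu vN; apply: contraT => uC.
have/negP[] := stC v u; apply/and4P; split=> //.
apply/forallP=> w; apply/implyP=> /andP[evw wC].
by apply: contraNT wC; apply: vN.
Qed.

(** Force greedily from [S]: every force adds a vertex, so after at most [#|V|] forces the colored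
    set is full or stalled, and a stalled one is full by hypothesis. *)
Lemma zero_forcing_stalled S :
    (forall C, S \subset C -> stalled C -> C = [set: V]) ->
  zero_forcing e S.
Proof.
move=> stS; rewrite /zero_forcing.
suffices [C SC <-] : exists2 C, connect (force_step e) S C & C = [set: V] by [].
suffices gen n : exists2 C, connect (force_step e) S C &
    S \subset C /\ (n <= #|C| \/ stalled C).
  have [C SC [sSC [VC|stC]]] := gen #|V|; exists C => //; last exact: stS.
  by apply/eqP; rewrite eqEcard subsetT cardsT.
elim: n => [|n [C SC [sSC [nC|stC]]]]; first by exists S => //; split=> //; left.
  case: (pickP (fun p : V * V => forces e C p.1 p.2)) => [[v u] /= fC|nof].
    exists (u |: C).
      apply: connect_trans SC (connect1 _); apply/existsP; exists v.
      by apply/existsP; exists u; rewrite fC eqxx.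
    split; first exact: subset_trans sSC (subsetUr _ _).
    by left; case/and4P: fC => _ uC _ _; rewrite cardsU1 uC.
  by exists C => //; split=> //; right=> v u; rewrite (nof (v, u)).
by exists C => //; split=> //; right.
Qed.

Lemma zero_forcing_number_le S :
  zero_forcing e S -> zero_forcing_number e <= #|S|.
Proof.
move=> zfS; rewrite /zero_forcing_number; case: arg_minnP => [|C _]; last exact.
exact: connect0.
Qed.

End Stalled.

(** * Matchings as involutions *)

Section Mates.
Variables (V : finType) (r : rel V).
Hypothesis r_sym : symmetric r.
Hypothesis r_fun : forall x y z, r x y -> r x z -> y = z.

(* Unmatched vertices are fixed. *)
Definition mate x := odflt x [pick y | r x y].

Lemma mateE x y : r x y -> mate x = y.
Proof.
by rewrite /mate => rxy; case: pickP => [z /r_fun/(_ rxy)|/(_ y)/negP[]].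
Qed.

Lemma mate_none x : (forall y, ~~ r x y) -> mate x = x.
Proof. by rewrite /mate => rx; case: pickP => // z rxz; case/negP: (rx z). Qed.

Lemma mateK : involutive mate.
Proof.
move=> x; have [/existsP[y rxy]|/existsPn rx] := boolP [exists y, r x y].
  by rewrite (mateE rxy); apply: mateE; rewrite r_sym.
by rewrite !(mate_none rx).
Qed.

End Mates.

(** The points of [A] that [g] moves split into pairs [x], [g x]; the induction removes one such
    pair at a time. *)
Lemma odd_card_involution (V : finType) (g : V -> V) (A : {set V}) :
    involutive g -> (forall x, x \in A -> g x \in A) ->
  odd #|A| = odd #|[set x in A | g x == x]|.
Proof.
move=> gK; have [n] := ubnP #|A|; elim: n A => // n IHn A /ltnSE An gA.
case: (pickP [pred x in A | g x != x]) => [x /= /andP[xA gx]|fixA]; last first.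
  congr odd; apply: eq_card => x; rewrite inE.
  by have /= := fixA x; case: (x \in A) => //= /negbFE ->.
have gxA := gA _ xA.
have gxA' : g x \in A :\ x by rewrite !inE gx.
have cA : #|A| = #|A :\ x :\ g x|.+2 by rewrite (cardsD1 x) xA (cardsD1 (g x)) gxA'.
rewrite cA /= negbK IHn.
- congr odd; apply: eq_card => y; rewrite !inE.
  case: (y =P x) => [->|_]; first by rewrite (negPf gx) !andbF.
  by case: (y =P g x) => [->|] //=; rewrite gK eq_sym (negPf gx) andbF.
- by apply: leq_trans An; rewrite cA ltnS.
move=> y; rewrite !inE => /and3P[ygx yx yA]; rewrite gA // andbT.
by rewrite (can_eq gK) yx; apply: contra ygx => /eqP <-; rewrite gK.
Qed.

(** * Triangle and diamond units *)

Lemma triangle_unitP (V : finType) (e : rel V) A : triangle_unit e A ->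
  #|A| = 3 /\ {in A &, forall y z, e y z = (y != z)}.
Proof.
case/existsP=> f /and3P[/injectiveP f_inj /eqP <- /forallP ef]; split.
  by rewrite card_imset // card_ord.
move=> _ _ /imsetP[i _ ->] /imsetP[j _ ->].
by rewrite (inj_eq f_inj); apply/eqP/(forallP (ef i)).
Qed.

Lemma diamond_unitP (V : finType) (e : rel V) A : diamond_unit e A ->
  exists a b c d,
    [/\ A = [set a; b; c; d], uniq [:: a; b; c; d],
        [/\ e a b, e a c, e b c, e b d & e c d] & ~~ e a d].
Proof.
case/existsP=> f /and3P[/injectiveP f_inj /eqP <- /forallP ef].
pose o k lk : 'I_4 := @Ordinal 4 k lk.
exists (f (o 0 isT)), (f (o 1 isT)), (f (o 2 isT)), (f (o 3 isT)).
have efE i j : e (f i) (f j) = diamond i j by apply/eqP/(forallP (ef i)).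
(* A pair containing a middle vertex [k] cannot be the missing edge. *)
have dE i j (k : 'I_4) : i != j -> k \in [set i; j] ->
    k \notin [set ord0; ord_max] -> diamond i j.
  by move=> ij kij kN; rewrite /diamond ij; apply: contraNneq kN => <-.
split.
- apply/setP=> x; rewrite !inE; apply/imsetP/idP => [[[k lk] _ ->]|].
    by rewrite !(inj_eq f_inj) -!val_eqE /=; case: k lk => [|[|[|[|]]]].
  by rewrite -!orbA => /or4P[] /eqP->; [exists (o 0 isT)|exists (o 1 isT)
    |exists (o 2 isT)|exists (o 3 isT)].
- by rewrite /= !inE !(inj_eq f_inj).
- split; rewrite efE.
  + by apply: (dE _ _ (o 1 isT)); rewrite ?inE.
  + by apply: (dE _ _ (o 2 isT)); rewrite ?inE.
  + by apply: (dE _ _ (o 2 isT)); rewrite ?inE.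
  + by apply: (dE _ _ (o 1 isT)); rewrite ?inE.
  + by apply: (dE _ _ (o 2 isT)); rewrite ?inE.
rewrite efE negb_and negbK; apply/orP; right; rewrite negbK; apply/eqP.
by congr [set _; _]; apply: val_inj.
Qed.

Section UnitGraph.
Variables (V : finType) (e : rel V) (P : {set {set V}}).
Hypothesis e_sym : symmetric e.
Hypothesis e_irr : irreflexive e.
Hypothesis e_cubic : cubic e.
Hypothesis P_units : unit_partition e P.

Local Notation unit := (pblock P).

Definition in_triangle x := unit x \in triangle_units e P.
Definition in_diamond x := unit x \in diamond_units e P.

Definition outer : rel V := fun x y => e x y && (unit x != unit y).
(** In a diamond this relates exactly the two ends of the missing edge; in a triangle it is
    empty. *)
Definition antipodal : rel V := fun x y =>
  [&& unit x == unit y, x != y & ~~ e x y].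
Definition port x := [exists y, outer x y].

Lemma mem_unit x y : (y \in unit x) = (unit x == unit y).
Proof.
have /andP[/and3P[/eqP coverP trivP _] _] := P_units.
by rewrite eq_pblock // coverP inE.
Qed.

Lemma unit_in x : unit x \in P.
Proof.
have /andP[/and3P[/eqP coverP _ _] _] := P_units.
by apply: pblock_mem; rewrite coverP inE.
Qed.

Lemma unit_eq A x : A \in P -> x \in A -> unit x = A.
Proof.
by have /andP[/and3P[_ trivP _] _] := P_units => AP xA; apply: def_pblock.
Qed.

Lemma triangle_not_diamond A : triangle_unit e A -> ~~ diamond_unit e A.
Proof.
move=> /triangle_unitP[A3 _]; apply/negP=> /diamond_unitP[a [b [c [d [AE u _ _]]]]].
suffices: #|A| = 4 by rewrite A3.
rewrite AE -[RHS]/(size [:: a; b; c; d]) -(card_uniqP u).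
by apply: eq_card => x; rewrite !inE !orbA.
Qed.

Lemma in_diamondE x : in_diamond x = ~~ in_triangle x.
Proof.
have /andP[_ /forallP/(_ (unit x))] := P_units.
rewrite /in_diamond /in_triangle !inE unit_in /=.
by case: (boolP (triangle_unit e _)) => [/triangle_not_diamond/negPf->|].
Qed.

Lemma in_triangle_cover x : (x \in cover (triangle_units e P)) = in_triangle x.
Proof.
apply/bigcupP/idP => [[A At xA]|xt]; last by exists (unit x); rewrite ?mem_unit.
by rewrite /in_triangle (unit_eq _ xA) //; move: At; rewrite inE => /andP[].
Qed.

Lemma outer_sym : symmetric outer.
Proof. by move=> x y; rewrite /outer e_sym eq_sym. Qed.

Lemma antipodal_sym : symmetric antipodal.
Proof. by move=> x y; rewrite /antipodal e_sym eq_sym [x == y]eq_sym. Qed.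

(** The unit consists of [x], its neighbors inside and its antipodal vertices, while the neighbors
    inside and outside total three. Eliminating the number of inside neighbors gives the
    equation. *)
Lemma card_outer_unit x :
  #|[set y | outer x y]| + #|unit x| = #|[set y | antipodal x y]| + 4.
Proof.
have := e_cubic x; rewrite -(cardsID (unit x)).
rewrite -(cardsID [set y | e x y] (unit x)).
rewrite (cardsD1 x (unit x :\: _)) !inE mem_unit eqxx e_irr /= setIC.
have -> : [set y | e x y] :\: unit x = [set y | outer x y].
  by apply/setP=> y; rewrite !inE mem_unit andbC.
have -> : (unit x :\: [set y | e x y]) :\ x = [set y | antipodal x y].
  apply/setP=> y; rewrite !inE mem_unit /antipodal eq_sym [RHS]andbCA.
  by congr (_ && _); rewrite andbC.
by move=> e3; rewrite addnA [X in X + _]addnC e3 addnCA addnA addnC.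
Qed.

Lemma antipodal_triangle x y : in_triangle x -> ~~ antipodal x y.
Proof.
rewrite /in_triangle inE => /andP[_ /triangle_unitP[_ adj]].
apply/and3P=> -[xy nxy]; rewrite adj ?nxy // mem_unit //.
Qed.

Lemma card_antipodal x : #|[set y | antipodal x y]| <= 1.
Proof.
case: (boolP (in_triangle x)) => [tx|].
  rewrite (_ : [set y | _] = set0) ?cards0 //.
  by apply/setP=> y; rewrite !inE (negPf (antipodal_triangle _ tx)).
rewrite -in_diamondE /in_diamond inE => /andP[_ /diamond_unitP[a [b [c [d]]]]].
move=> [UE _ [ab ac bc bd cd] _].
suffices [z sz] : exists z, [set y | antipodal x y] \subset [set z].
  by rewrite -(cards1 z) subset_leq_card.
have [ba ca cb db dc] : [/\ e b a, e c a, e c b, e d b & e d c].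
  by rewrite ![e b a]e_sym ![e c _]e_sym ![e d _]e_sym.
suffices [z zP] : exists z, forall y, y \in [set a; b; c; d] ->
    y != x -> ~~ e x y -> y = z.
  exists z; apply/subsetP=> y; rewrite !inE => /and3P[].
  rewrite -mem_unit UE eq_sym => yU yx xy; apply/eqP; exact: zP.
have: x \in unit x by rewrite mem_unit.
(* The ends [a] and [d] miss each other; [b] and [c] miss no other vertex, so their witness is
   arbitrary. *)
rewrite UE !inE -!orbA => /or4P[] /eqP->; [exists d|exists b|exists c|exists a];
  by move=> y; rewrite !inE -!orbA => /or4P[] /eqP-> //;
    rewrite ?eqxx ?ab ?ac ?bc ?bd ?cd ?ba ?ca ?cb ?db ?dc.
Qed.

Lemma card_unit x : #|unit x| = if in_triangle x then 3 else 4.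
Proof.
case: (boolP (in_triangle x)) => [|].
  by rewrite /in_triangle inE => /andP[_ /triangle_unitP[]].
rewrite -in_diamondE /in_diamond inE => /andP[_ /diamond_unitP[a [b [c [d [-> u _ _]]]]]].
rewrite -[RHS]/(size [:: a; b; c; d]) -(card_uniqP u).
by apply: eq_card => x'; rewrite !inE !orbA.
Qed.

(** With units of size 3 or 4, the count above shows that the ports of a diamond are the ends of its
    missing edge and that no vertex has two outer neighbors. *)
Lemma card_outer x : #|[set y | outer x y]| =
  if in_triangle x then 1 else #|[set y | antipodal x y]|.
Proof.
have := card_outer_unit x; rewrite card_unit; case: ifP => [tx|_ /addIn//].
rewrite (_ : [set y | antipodal x y] = set0) ?cards0; first by move/(@addIn 3 _ 1).
by apply/setP=> y; rewrite !inE (negPf (antipodal_triangle _ tx)).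
Qed.

Lemma outer_fun x y z : outer x y -> outer x z -> y = z.
Proof.
have outer1 : #|[set w | outer x w]| <= 1.
  by rewrite card_outer; case: ifP => // _; apply: card_antipodal.
move=> xy xz; apply/eqP; apply: contraTT outer1 => yz; rewrite -ltnNge.
by apply/card_gt1P; exists y, z; rewrite !inE.
Qed.

Lemma antipodal_fun x y z : antipodal x y -> antipodal x z -> y = z.
Proof.
move=> xy xz; apply/eqP; apply: contraTT (card_antipodal x) => yz; rewrite -ltnNge.
by apply/card_gt1P; exists y, z; rewrite !inE.
Qed.

Lemma port_triangle x : in_triangle x -> port x.
Proof.
move=> tx; have: 0 < #|[set y | outer x y]| by rewrite card_outer tx.
by case/card_gt0P=> y; rewrite inE => xy; apply/existsP; exists y.
Qed.

Lemma port_diamond x : in_diamond x -> port x = [exists y, antipodal x y].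
Proof.
rewrite in_diamondE => /negPf tx; have := card_outer x; rewrite tx => cE.
have cP (r : rel V) : [exists y, r x y] = (0 < #|[set y | r x y]|).
  by apply/existsP/card_gt0P => -[y]; rewrite ?inE => ?; exists y; rewrite ?inE.
by rewrite /port !cP cE.
Qed.

(** As total involutions, [outmate] fixes the vertices that are not ports, and [mirror] fixes the
    triangle vertices and the middles of diamonds. *)
Definition outmate := mate outer.
Definition mirror := mate antipodal.

Lemma outmateE x y : outer x y -> outmate x = y.
Proof. exact: (mateE outer_fun). Qed.

Lemma outmateK : involutive outmate.
Proof. exact: mateK outer_sym outer_fun. Qed.

Lemma mirrorE x y : antipodal x y -> mirror x = y.
Proof. exact: (mateE antipodal_fun). Qed.

Lemma mirrorK : involutive mirror.
Proof. exact: mateK antipodal_sym antipodal_fun. Qed.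

Lemma outer_outmate x : port x -> outer x (outmate x).
Proof. by case/existsP=> y xy; rewrite (outmateE xy). Qed.

Lemma mirror_triangle x : in_triangle x -> mirror x = x.
Proof. by move=> tx; apply: mate_none => y; apply: antipodal_triangle. Qed.

Lemma antipodal_mirror x : in_diamond x -> port x -> antipodal x (mirror x).
Proof.
by move=> dx; rewrite port_diamond // => /existsP[y xy]; rewrite (mirrorE xy).
Qed.

Lemma port_outmate x : port (outmate x) = port x.
Proof.
suffices imp y : port y -> port (outmate y).
  by apply/idP/idP=> [/imp|/imp//]; rewrite outmateK.
move=> py; apply/existsP; exists y; rewrite outer_sym; exact: outer_outmate.
Qed.

Lemma unit_mirror x : unit (mirror x) = unit x.
Proof.
have [/existsP[y xy]|/existsPn xN] := boolP [exists y, antipodal x y].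
  by rewrite (mirrorE xy); case/and3P: xy => /eqP.
by rewrite /mirror mate_none.
Qed.

Lemma port_mirror x : port x -> port (mirror x).
Proof.
move=> px; have [tx|] := boolP (in_triangle x); first by rewrite mirror_triangle.
rewrite -in_diamondE => dx; have := antipodal_mirror dx px.
rewrite port_diamond /in_diamond ?unit_mirror // => xm.
by apply/existsP; exists x; rewrite antipodal_sym.
Qed.

Lemma diamond_vertices x : in_diamond x -> exists a b c d,
  [/\ unit x = [set a; b; c; d],
      [/\ e a b, e a c, e b c, e b d & e c d],
      antipodal a d, ~~ port b & ~~ port c].
Proof.
move=> dx; have := dx.
rewrite /in_diamond inE => /andP[_ /diamond_unitP[a [b [c [d [UE u [ab ac bc bd cd] ad]]]]]].
have [Ua Ub Uc Ud] : [/\ unit x = unit a, unit x = unit b, unit x = unit c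
    & unit x = unit d].
  by split; apply/eqP; rewrite -mem_unit UE !inE eqxx ?orbT.
have middle z : unit x = unit z ->
    (forall y, y \in [set a; b; c; d] -> y != z -> e z y) -> ~~ port z.
  move=> Uz zadj; rewrite port_diamond /in_diamond -?Uz //.
  apply/existsP=> -[y /and3P[]]; rewrite -Uz -mem_unit UE eq_sym => yU yz.
  by rewrite zadj.
exists a, b, c, d; split=> //.
- rewrite /antipodal -Ua -Ud eqxx ad andbT.
  by apply: contraTneq u => ->; rewrite /= !inE eqxx !orbT.
- apply: middle => // y; rewrite !inE -!orbA => /or4P[] /eqP-> //.
    by rewrite e_sym.
  by rewrite eqxx.
apply: middle => // y; rewrite !inE -!orbA => /or4P[] /eqP-> //.
- by rewrite e_sym.
- by rewrite e_sym.
by rewrite eqxx.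
Qed.

Lemma mirror_port x y : in_diamond x -> port x -> port y ->
  unit x = unit y -> x != y -> mirror x = y.
Proof.
move=> dx px py /eqP; rewrite -mem_unit => yU xy.
have xU : x \in unit x by rewrite mem_unit.
have [a [b [c [d [UE _ ad pb pc]]]]] := diamond_vertices dx.
have portU z : port z -> z \in unit x -> z = a \/ z = d.
  move=> pz; rewrite UE !inE -!orbA => /or4P[] /eqP zE; [by left| | |by right].
    by rewrite zE (negPf pb) in pz.
  by rewrite zE (negPf pc) in pz.
have [[] xE [] yE] := (portU x px xU, portU y py yU); rewrite xE yE in xy *.
- by rewrite eqxx in xy.
- exact: mirrorE.
- by apply: mirrorE; rewrite antipodal_sym.
by rewrite eqxx in xy.
Qed.

(** * Spreading along diamond sequences *)

(** On ports, the connected classes of [step] are the routes that alternately follow an edge between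
    units and cross a diamond. They can end only at triangle vertices, the ports that [mirror]
    fixes. *)
Definition step : rel V := fun x y => (y == outmate x) || (y == mirror x).

Lemma step_sym : symmetric step.
Proof.
move=> x y; rewrite /step -[y == outmate x](inj_eq (can_inj outmateK)) outmateK.
rewrite -[y == mirror x](inj_eq (can_inj mirrorK)) mirrorK.
by rewrite eq_sym [mirror y == x]eq_sym.
Qed.

Lemma step_connect_sym : connect_sym step.
Proof. exact: sym_connect_sym step_sym. Qed.

Lemma connect_port x y : connect step x y -> port x -> port y.
Proof.
have cl : closed step port.
  apply: (intro_closed step_connect_sym) => u v /orP[] /eqP->.
    by rewrite /in_mem /= port_outmate.
  exact: port_mirror.
by move/(closed_connect cl); rewrite /in_mem /= => ->.
Qed.

Section Spread.
Variable C : {set V}.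
Hypothesis stC : stalled e C.
Hypothesis middleC : forall x, in_diamond x ->
  exists m, [/\ unit m = unit x, ~~ port m & m \in C].

(** Only one neighbor of [x] lies outside its unit, so a fully colored unit lets [x] force it. *)
Lemma unit_spread x y : unit x \subset C -> e x y -> y \in C.
Proof.
move=> UC exy; have [Uxy|Uxy] := eqVneq (unit x) (unit y).
  by rewrite (subsetP UC) // mem_unit Uxy.
apply: (stalled_force stC _ exy) => [|w exw wy].
  by rewrite (subsetP UC) // mem_unit.
have [Uxw|Uxw] := eqVneq (unit x) (unit w).
  by rewrite (subsetP UC) // mem_unit Uxw.
have xw : outer x w by rewrite /outer exw.
by case/eqP: wy; apply: outer_fun xw _; rewrite /outer exy.
Qed.

(** The neighbors of [x] are [outmate x] and the two middles. One middle [m] is colored, so [x]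
    forces the other, [m']; then [m], which has no outer neighbor, forces [mirror x]. *)
Lemma diamond_spread x :
  in_diamond x -> port x -> x \in C -> outmate x \in C -> unit x \subset C.
Proof.
move=> dx px xC oxC; have [m [Um pm mC]] := middleC dx.
have xM := antipodal_mirror dx px; have /and3P[/eqP UM xMn _] := xM.
have m_adj w : unit w = unit x -> w != m -> e m w.
  move=> Uw wm; apply: contraNT pm => mw.
  rewrite port_diamond /in_diamond ?Um //; apply/existsP; exists w.
  by rewrite /antipodal Um Uw eqxx eq_sym wm.
have [xm Mm] : x != m /\ mirror x != m.
  by split; apply: contraNneq pm => <-; rewrite ?port_mirror.
have /cards1P[m' m'E] : #|unit x :\ x :\ mirror x :\ m| == 1.
  have := card_unit x; rewrite -[in_triangle x]negbK -in_diamondE dx /=.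
  rewrite (cardsD1 x) (cardsD1 (mirror x)) (cardsD1 m) !inE !mem_unit eqxx.
  by rewrite -UM Um !eqxx eq_sym xMn ![m == _]eq_sym xm Mm => /eqP.
have UE w : unit w = unit x -> [\/ w = x, w = mirror x, w = m | w = m'].
  move=> Uw; move/setP/(_ w): m'E; rewrite !inE mem_unit Uw eqxx andbT.
  case: (w =P m) => [->|_]; first by constructor 3.
  case: (w =P mirror x) => [->|_]; first by constructor 2.
  by case: (w =P x) => [->|_ /esym/eqP->]; [constructor 1|constructor 4].
have [m'm m'x Um'] : [/\ m' != m, m' != x & unit m' = unit x].
  have: m' \in [set m'] by rewrite inE.
  by rewrite -m'E !inE mem_unit => /and4P[-> _ -> /eqP].
have m'M : m' != mirror x.
  by have := set11 m'; rewrite -m'E !inE => /and3P[].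
have m'C : m' \in C.
  apply: (stalled_force stC xC) => [|w exw wm'].
    apply: contraTT m'M => xm'; rewrite negbK eq_sym; apply/eqP.
    by apply: mirrorE; rewrite /antipodal Um' eqxx eq_sym m'x.
  have [/esym/UE[] wE|Uxw] := eqVneq (unit x) (unit w); try by rewrite wE.
  - by case/and3P: xM => _ _; rewrite -wE exw.
  - by rewrite wE eqxx in wm'.
  by rewrite -(outmateE (x := x) (y := w)) // /outer exw.
have MC : mirror x \in C.
  apply: (stalled_force stC mC) => [|w emw wM]; first exact: m_adj.
  have [Umw|Umw] := eqVneq (unit m) (unit w).
    by have [wE|wE|wE|wE] := UE w (etrans (esym Umw) Um);
       rewrite wE ?eqxx // in wM *.
  by case/existsP: pm; exists w; rewrite /outer emw.
by apply/subsetP=> w; rewrite mem_unit eq_sym => /eqP/UE[] ->.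
Qed.

(** Having both ends of the outer edge colored is invariant under [step]: [outmate] exchanges the
    two ends, and for [mirror] the whole diamond fills up and its other port forces its outer
    neighbor. *)
Lemma connect_spread x y : port x -> x \in C -> outmate x \in C ->
  connect step x y -> (y \in C) && (outmate y \in C).
Proof.
move=> px xC oxC cxy.
pose act := [pred u | [&& port u, u \in C & outmate u \in C]].
have cl : closed step act.
  apply: (intro_closed step_connect_sym) => u v.
  rewrite !inE => /orP[] /eqP-> /and3P[pu uC ouC].
    by rewrite port_outmate pu outmateK ouC.
  rewrite port_mirror //=; have [tu|] := boolP (in_triangle u).
    by rewrite mirror_triangle ?uC.
  rewrite -in_diamondE => du; have UC := diamond_spread du pu uC ouC.
  rewrite (subsetP UC) /=; last by rewrite mem_unit unit_mirror.
  apply: (unit_spread (x := mirror u)); first by rewrite unit_mirror.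
  by have /andP[] := outer_outmate (port_mirror pu).
have := closed_connect cl cxy; rewrite !inE px xC oxC /=.
by case/esym/and3P=> _ -> ->.
Qed.

Lemma triangle_spread x y : in_triangle x -> unit x \subset C ->
  connect step x y -> (y \in C) && (outmate y \in C).
Proof.
move=> tx UC; apply: connect_spread; first exact: port_triangle.
  by rewrite (subsetP UC) ?mem_unit.
apply: unit_spread UC _.
by have /andP[] := outer_outmate (port_triangle tx).
Qed.

(** Being in a fully colored unit passes along every edge: triangles are colored by hypothesis, and
    a diamond next to a full unit gets both ends of the connecting edge colored, then fills up.
    Connectedness concludes. *)
Lemma all_spread x : connected_graph e -> unit x \subset C ->
  (forall y, in_triangle y -> y \in C) -> C = [set: V].
Proof.
move=> [_ conn] UC triC; apply/setP=> y; rewrite inE.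
suffices cl : closed e [pred u | unit u \subset C].
  have := closed_connect cl (conn x y); rewrite !inE UC => /esym/subsetP->//.
  by rewrite mem_unit.
apply: intro_closed; first exact: sym_connect_sym.
move=> u v euv; rewrite !inE => UuC.
have [<- //|Uuv] := eqVneq (unit u) (unit v).
have vu : outer v u by rewrite outer_sym /outer euv.
have [tv|] := boolP (in_triangle v).
  apply/subsetP=> w; rewrite mem_unit => /eqP Uw.
  by apply: triC; rewrite /in_triangle -Uw.
rewrite -in_diamondE => dv; apply: diamond_spread => //.
- by apply/existsP; exists u.
- exact: unit_spread euv.
by rewrite (outmateE vu) (subsetP UuC) ?mem_unit.
Qed.
End Spread.

(** * Edges of the contraction multigraph *)

(** Iterated from [outmate x], this lists the arrival vertices in the successive units met when
    leaving the unit of [x] through [x]. *)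
Definition across x := outmate (mirror x).

Lemma connect_across x n : connect step x (iter n across (outmate x)).
Proof.
elim: n => [|n IHn] /=; first by apply: connect1; rewrite /step eqxx.
apply: connect_trans IHn _; set u := iter _ _ _.
apply: (connect_trans (y := mirror u)); apply: connect1.
  by rewrite /step eqxx orbT.
by rewrite /step /across eqxx.
Qed.

(** The route is forced: a diamond entered at [a] can be left, other than back to [x], only through
    its second port. The induction restarts from the exit port [a'] of the first diamond. *)
Lemma linked_walk s x a b y :
    all (mem (diamond_units e P)) s -> uniq s -> sorted (linked e) s ->
    s != [::] -> unit x \notin s ->
    a \in head set0 s -> e x a -> b \in last set0 s -> e b y ->
    in_triangle y -> x != y ->
  s = [seq unit u | u <- traject across (outmate x) (size s)] /\
  y = iter (size s) across (outmate x).
Proof.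
elim: s x a => // D s IHs x a /= /andP[dD ds] /andP[Ds us] ls _.
rewrite inE negb_or => /andP[xD xs] aD exa bl eby ty xy.
have DP : D \in P by move: dD; rewrite !inE => /andP[].
have Ua : unit a = D by exact: unit_eq.
have da : in_diamond a by rewrite /in_diamond Ua.
have oxa : outer x a by rewrite /outer exa Ua.
have pa : port a by apply/existsP; exists x; rewrite outer_sym.
rewrite (outmateE oxa) Ua -iterS iterSr.
(* Since [outmate a] is [x], an exit to another vertex uses a port different from [a], hence its
   mirror image. *)
have away a' b' : a' \in D -> outer a' b' -> b' != x -> across a = b'.
  move=> a'D oa'b' b'x; rewrite /across (mirror_port (y := a')) ?(outmateE oa'b') //.
  - by apply/existsP; exists b'.
  - by rewrite Ua (unit_eq DP).
  apply: contraNneq b'x => aa'; rewrite -(outmateE oa'b') -aa'.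
  by rewrite (outmateE (y := x)) // outer_sym.
case: s IHs ds Ds us ls xs bl => [|D2 s] IHs ds Ds us ls xs bl /=.
  rewrite (away b y) //; last by rewrite eq_sym.
  rewrite /outer eby (unit_eq DP bl) -Ua; apply/eqP=> U.
  by move: da; rewrite in_diamondE /in_triangle U -/(in_triangle y) ty.
have /= /andP[/existsP[a' /andP[a'D /existsP[b' /andP[b'D2 ea'b']]]] ls2] := ls.
have D2P : D2 \in P.
  have: D2 \in diamond_units e P by case/andP: ds.
  by rewrite inE => /andP[].
have Ua' : unit a' = D by exact: unit_eq.
have Ub' : unit b' = D2 by exact: unit_eq.
have oa'b' : outer a' b'.
  by rewrite /outer ea'b' Ua' Ub'; apply: contraNneq Ds => ->; rewrite inE eqxx.
have b'x : b' != x.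
  by apply: contraNneq xs => <-; rewrite Ub' inE eqxx.
have a'y : a' != y.
  apply/eqP=> a'yE; move: da; rewrite in_diamondE /in_triangle Ua -Ua' a'yE.
  by rewrite -/(in_triangle y) ty.
have a's : unit a' \notin D2 :: s by rewrite Ua'.
have [sE yE] := IHs a' b' ds us ls2 isT a's b'D2 ea'b' bl eby ty a'y.
move: sE yE; rewrite (outmateE oa'b') -(away a' b') // => sE yE.
split; last exact: yE.
by congr (_ :: _); exact: sE.
Qed.

Local Notation MG := (contraction_multigraph e P).

(** Kept and added edges are treated alike as walks from either end, a kept edge having [n = 0]. The
    last clause says that the walk stops at the first triangle it meets. *)
Lemma contraction_edge f x : f \in medges MG -> x \in f.1 ->
  exists n, let y := iter n across (outmate x) in
    [/\ in_triangle x, in_triangle y, f.1 = [set x; y],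
        f.2 = [set:: [seq unit u | u <- traject across (outmate x) n]]
      & forall k, k < n -> in_diamond (iter k across (outmate x))].
Proof.
rewrite /= in_setD in_setU => /andP[fT]; case/orP=> [fK|].
  move: (fK); rewrite inE => /andP[/eqP f2 /existsP[y /andP[]]].
  rewrite in_triangle_cover => ty /existsP[z /andP[]].
  rewrite in_triangle_cover => tz /andP[eyz /eqP f1].
  have oyz : outer y z.
    (* A kept edge inside one unit would be a triangle edge, and those are deleted. *)
    rewrite /outer eyz; apply: contraNneq fT => Uyz; rewrite inE fK.
    apply/existsP; exists (unit y); rewrite -/(in_triangle y) ty f1.
    by apply/subsetP=> w; rewrite !inE mem_unit => /orP[] /eqP-> //; rewrite Uyz.
  rewrite f1 !inE => xyz; exists 0 => /=; rewrite f2.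
  have setnil : set0 = [set:: ([::] : seq {set V})] by apply/setP=> A; rewrite !inE.
  case/orP: xyz => /eqP->.
    by rewrite (outmateE oyz).
  by rewrite (@outmateE z y) ?(outer_sym z) // setUC.
rewrite inE => /existsP[y /andP[]].
rewrite in_triangle_cover => ty /existsP[z /andP[]].
rewrite in_triangle_cover => tz /andP[/eqP f1 /hasP[s]].
rewrite mem_permutations => sf /andP[/andP[/and4P[s0 ds us ls] _]].
case/and3P=> yz /existsP[a /andP[ah eya]] /existsP[b /andP[bl ebz]].
have f2 : f.2 = [set:: s].
  by apply/setP=> A; rewrite inE (perm_mem sf) mem_enum.
have notin w : in_triangle w -> unit w \notin s.
  move=> tw; apply: contraL tw => /(allP ds) dw.
  by rewrite -in_diamondE.
(* Stated for any ordering [s'] of the diamonds, to serve both for [s] read from [y] and for [rev s]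
   read from [z]. *)
have walk w t : w != t -> in_triangle w -> in_triangle t -> forall s' a' b',
    s' =i s -> all (mem (diamond_units e P)) s' -> uniq s' ->
    sorted (linked e) s' -> s' != [::] ->
    a' \in head set0 s' -> e w a' -> b' \in last set0 s' -> e b' t ->
    exists n, let y := iter n across (outmate w) in
    [/\ in_triangle w, in_triangle y, [set w; t] = [set w; y],
        [set:: s] = [set:: [seq unit u | u <- traject across (outmate w) n]]
      & forall k, k < n -> in_diamond (iter k across (outmate w))].
  move=> wt tw tt s' a' b' s's ds' us' ls' s'0 a'h ewa' b'l eb't.
  have ws' : unit w \notin s' by rewrite s's notin.
  have [sE tE] := linked_walk ds' us' ls' s'0 ws' a'h ewa' b'l eb't tt wt.
  exists (size s'); rewrite -tE -sE; split=> //.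
    by apply/setP=> A; rewrite !inE s's.
  move=> k ks; apply: (allP ds'); rewrite sE; apply/map_f/trajectP; by exists k.
rewrite f1 f2 !inE => /orP[] /eqP->.
  exact: (walk y z yz ty tz s a b).
rewrite setUC; apply: (walk z y _ tz ty (rev s) b a); rewrite ?all_rev ?rev_uniq //.
- by rewrite eq_sym.
- by move=> A; rewrite mem_rev.
- rewrite rev_sorted; apply: sub_sorted ls => A B.
  case/existsP=> u /andP[uA /existsP[v /andP[vB euv]]].
  apply/existsP; exists v; rewrite vB; apply/existsP; exists u.
  by rewrite uA e_sym.
- by rewrite -size_eq0 size_rev size_eq0.
- by case/lastP: {+}s bl => // s' D; rewrite rev_rcons last_rcons.
- by rewrite e_sym.
- by case: {+}s ah => // D s'; rewrite rev_cons last_rcons.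
by rewrite e_sym.
Qed.

(** The length [n] of the walk is the first time it meets a triangle, so it depends only on [x], and
    it determines both components of the edge. *)
Lemma contraction_edge_inj f f' x : f \in medges MG -> f' \in medges MG ->
  x \in f.1 -> x \in f'.1 -> f = f'.
Proof.
move=> fM f'M xf xf'.
have [n /= [_ tn f1 f2 dn]] := contraction_edge fM xf.
have [n' /= [_ tn' f'1 f'2 dn']] := contraction_edge f'M xf'.
suffices nn' : n = n' by apply: injective_projections; rewrite ?f1 ?f2 nn' ?f'1 ?f'2.
case: (ltngtP n n') => // [/dn'|/dn]; by rewrite in_diamondE ?tn ?tn'.
Qed.

(** * The chords of the Hamiltonian cycle *)

(* On the ports of an orbit, [outmate] has no fixed point and those of [mirror]
   are the triangle vertices. *)
Lemma odd_connect_triangles u : port u ->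
  ~~ odd (\sum_(v | in_triangle v) connect step u v).
Proof.
move=> pu; rewrite -big_mkcondr sum1dep_card.
pose A := [set v | connect step u v].
have stepA v w : step v w -> v \in A -> w \in A.
  by rewrite !inE => vw uv; apply: connect_trans uv (connect1 vw).
have portA v : v \in A -> port v by rewrite inE => uv; apply: connect_port uv pu.
have stm v : v \in A -> mirror v \in A.
  by apply: stepA; rewrite /step eqxx orbT.
have sto v : v \in A -> outmate v \in A.
  by apply: stepA; rewrite /step eqxx.
have := odd_card_involution mirrorK stm; rewrite (odd_card_involution outmateK sto).
rewrite (_ : [set v in A | outmate v == v] = set0) ?cards0; last first.
  apply/setP=> v; rewrite inE [RHS]inE; apply/andP=> -[/portA pv /eqP ov].
  by have := outer_outmate pv; rewrite ov /outer e_irr.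
rewrite (_ : [set v in A | _] = [set v | in_triangle v && connect step u v]).
  by move=> <-.
apply/setP=> v; rewrite [LHS]inE [RHS]inE andbC.
have [vA|] := boolP (v \in A); last by rewrite inE => /negPf->; rewrite !andbF.
have pv := portA v vA; move: vA; rewrite inE => ->; rewrite !andbT.
have [tv|] := boolP (in_triangle v); first by rewrite mirror_triangle ?eqxx.
rewrite -in_diamondE => dv; have /and3P[_ vm _] := antipodal_mirror dv pv.
by rewrite eq_sym (negPf vm).
Qed.

Lemma pblock_triangle_units v :
  in_triangle v -> pblock (triangle_units e P) v = unit v.
Proof.
move=> tv; have /andP[/and3P[_ trivP _] _] := P_units.
apply: def_pblock tv _; last by rewrite mem_unit.
by apply: trivIsetS trivP; apply/subsetP=> A; rewrite inE => /andP[].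
Qed.

(* The cycle enters the triangle [t i] at [y i] and leaves it at [x i]. *)
Lemma hamiltonian_ports : hamiltonian MG ->
  exists n (t : 'I_n -> {set V}) (x y z : 'I_n -> V),
    [/\ 1 < n, injective t & triangle_units e P = [set t i | i : 'I_n]] /\
    forall i, [/\ t i =i [:: x i; y i; z i], uniq [:: x i; y i; z i]
                & connect step (x i) (y (ordS i))].
Proof.
case=> vs [es [[n1 vs_uniq vsE] [es_uniq es_sub esE]]].
set n := size vs in n1; have n0 : 0 < n by apply: ltnW.
have es_size : size es = n.
  by rewrite -(size_map (mends MG)) esE size_map size_zip size_rot minnn.
pose t (i : 'I_n) := nth set0 vs i.
have t_inj : injective t.
  by move=> i j /eqP; rewrite nth_uniq // => /eqP/val_inj.
have tE : triangle_units e P = [set t i | i : 'I_n].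
  rewrite -[LHS]vsE; apply/setP=> A; rewrite inE; apply/idP/imsetP.
    case/(nthP set0)=> k kn <-; by exists (Ordinal kn).
  by case=> i _ ->; apply: mem_nth.
have tT i : t i \in triangle_units e P by rewrite tE imset_f.
pose f0 : {set V} * {set {set V}} := (set0, set0).
pose f (i : 'I_n) := nth f0 es i.
have fM i : f i \in medges MG by apply: es_sub; rewrite mem_nth ?es_size.
have ordS_neq i : ordS i != i :> 'I_n.
  apply/eqP=> /(congr1 val) /= Si; case: (ltngtP i.+1 n) (ltn_ord i) => // Sn _.
    by move: Si; rewrite modn_small // => /esym/n_Sn.
  by move: Si; rewrite Sn modnn => iE; move: n1; rewrite -Sn -iE.
have fE i : [set unit v | v in (f i).1] = [set t i; t (ordS i)].
  transitivity (mends MG (f i)).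
    apply: eq_in_imset => v vf; rewrite pblock_triangle_units //.
    by have [k []] := contraction_edge (fM i) vf.
  have iz : i < size (zip vs (rot 1 vs)) by rewrite size_zip size_rot minnn.
  have := congr1 (nth set0 ^~ i) esE; rewrite (nth_map f0) ?es_size //.
  rewrite (nth_map (set0, set0)) // nth_zip ?size_rot //= => ->.
  (* Entry [i] of [rot 1 vs] is the next vertex, or vertex 0 when [i] is the last index; [ordS]
     wraps around in the same way. *)
  congr [set _; _]; rewrite nth_cat /t size_drop; case: ltnP => iS.
    rewrite nth_drop add1n /= modn_small //.
    by rewrite ltn_subRL add1n in iS.
  have iE : i.+1 = n.
    by apply/eqP; rewrite eqn_leq ltn_ord; rewrite leq_subLR add1n in iS.
  have nE : size vs - 1 = i by rewrite subn1 -(congr1 predn iE).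
  by rewrite /= iE modnn nE subnn nth_take.
have /fin_all_exists[x xP] : forall i, exists x, x \in (f i).1 /\ unit x = t i.
  move=> i; have: t i \in [set unit v | v in (f i).1] by rewrite fE !inE eqxx.
  by case/imsetP=> v vf ->; exists v.
have /fin_all_exists[y yP] : forall i,
    exists y, y \in (f (ord_pred i)).1 /\ unit y = t i.
  move=> i; have: t i \in [set unit v | v in (f (ord_pred i)).1].
    by rewrite fE !inE ord_predK eqxx orbT.
  by case/imsetP=> v vf ->; exists v.
have xy i : x i != y i.
  (* If entry and exit coincided, the two consecutive cycle edges would be equal. Distinctness of
     the edges excludes this even when [n = 2]. *)
  have [[xf _] [yf _]] := (xP i, yP i); apply: contraTneq (ordS_neq (ord_pred i)).
  move=> xyE; rewrite negbK ord_predK; apply/eqP/val_inj/eqP.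
  rewrite -(nth_uniq f0 _ _ es_uniq) ?es_size ?ltn_ord //; apply/eqP.
  by apply: contraction_edge_inj (fM _) (fM _) xf _; rewrite xyE.
have xt i : x i \in t i.
  by rewrite -(proj2 (xP i)) mem_unit.
have yt i : y i \in t i.
  by rewrite -(proj2 (yP i)) mem_unit.
have /fin_all_exists[z zP] : forall i,
    exists z, t i =i [:: x i; y i; z] /\ uniq [:: x i; y i; z].
  move=> i; have /cards1P[z zE] : #|t i :\ x i :\ y i| == 1.
    have := tT i; rewrite inE => /andP[_ /triangle_unitP[]].
    rewrite (cardsD1 (x i)) xt (cardsD1 (y i)) !inE yt (eq_sym (y i)) xy /= !add1n.
    by case=> ->.
  have := set11 z; rewrite -zE !inE => /and3P[zy zx zt].
  exists z; split; last by rewrite /= !inE negb_or xy !(eq_sym _ z) zy zx.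
  move=> v; move/setP/(_ v): zE; rewrite !inE.
  case: (v =P x i) => [->|_]; first by rewrite xt.
  by case: (v =P y i) => [->|_] /=; first by rewrite yt.
exists n, t, x, y, z; split=> // i; have [tiE tiU] := zP i; split=> //.
have [xf xU] := xP i; have [yf yU] := yP (ordS i); rewrite ordSK in yf.
have [m /= [_ _ f1 _ _]] := contraction_edge (fM i) xf.
move: yf; rewrite f1 !inE => /orP[] /eqP->; last exact: connect_across.
exact: connect0.
Qed.

(** * Pairing the third ports and coloring the triangles in cycle order *)

Section Cycle.
Variables (n : nat) (t : 'I_n -> {set V}) (x y z : 'I_n -> V).
Hypothesis t_inj : injective t.
Hypothesis tE : triangle_units e P = [set t i | i : 'I_n].
Hypothesis txyz : forall i, t i =i [:: x i; y i; z i].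
Hypothesis uxyz : forall i, uniq [:: x i; y i; z i].
Hypothesis xy_connect : forall i, connect step (x i) (y (ordS i)).

Lemma cycle_triangle i v : v \in t i -> in_triangle v /\ unit v = t i.
Proof.
move=> vt; have tT : t i \in triangle_units e P by rewrite tE imset_f.
by rewrite /in_triangle (unit_eq _ vt) //; move: tT; rewrite inE => /andP[].
Qed.

(** The class of [z i] contains an even number of triangle vertices. As [x j] and [y (ordS j)] are
    connected, the [x] and [y] contributions agree and cancel modulo 2. So the number of [z j] in
    the class is even, and [z i] is not alone. *)
Lemma chord_partner i : exists2 j, j != i & connect step (z i) (z j).
Proof.
have zt : z i \in t i by rewrite txyz !inE eqxx !orbT.
have := odd_connect_triangles (port_triangle (cycle_triangle zt).1).
rewrite (partition_big (pblock P) (mem (triangle_units e P))) //=.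
rewrite tE big_imset /=; last by move=> ? ? _ _; apply: t_inj.
pose c v : nat := connect step (z i) v.
rewrite (eq_bigr (fun j => c (x j) + (c (y j) + c (z j)))); last first.
  move=> j _; transitivity (\sum_(v <- [:: x j; y j; z j]) c v).
    rewrite big_uniq ?uxyz //=; apply: eq_bigl => v; rewrite -txyz.
    apply/andP/idP => [[_ /eqP <-]|/cycle_triangle[-> ->]] //.
    by rewrite mem_unit.
  by rewrite !big_cons big_nil addn0.
rewrite !big_split /= [X in _ + (X + _)](reindex_inj (@ordS_inj n)) /=.
rewrite [X in _ + (X + _)](eq_bigr (fun j => c (x j))); last first.
  move=> j _; rewrite /c; congr nat_of_bool.
  rewrite ![connect step (z i) _]step_connect_sym.
  by rewrite (same_connect step_connect_sym (xy_connect j)).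
rewrite addnA oddD addnn odd_double (bigD1 i) //= {1}/c connect0 negbK.
have [j /= /andP[ji zj]|none] := pickP [pred j | (j != i) && connect step (z i) (z j)].
  by move=> _; exists j.
rewrite big1 // => j ji; rewrite /c; have /= := none j; by rewrite ji /= => ->.
Qed.

Definition chord_heads := [set i | [forall j, connect step (z i) (z j) ==> (i <= j)]].

(** A head is the least index in its class, so a partner of a head is not a head, and heads with a
    common partner are equal. Choosing partners thus injects the heads into their complement. *)
Lemma chord_heads_half : #|chord_heads|.*2 <= n.
Proof.
have /fin_all_exists2[g gi zg] := chord_partner.
have headP i j : i \in chord_heads -> connect step (z i) (z j) -> i <= j.
  by rewrite inE => /forallP/(_ j)/implyP.
have g_tail i : i \in chord_heads -> g i \notin chord_heads.
  move=> ih; apply: contra (gi i) => gih; apply/eqP/val_inj/eqP.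
  by rewrite eqn_leq (headP i) // (headP (g i)) // step_connect_sym.
have g_inj : {in chord_heads &, injective g}.
  move=> i j ih jh gij; apply: val_inj; apply/eqP; rewrite eqn_leq.
  have zij : connect step (z i) (z j).
    by apply: connect_trans (zg i) _; rewrite gij step_connect_sym.
  by rewrite (headP i) // (headP j) // step_connect_sym.
rewrite -addnn -[leqRHS]card_ord -(cardC (mem chord_heads)) leq_add2l.
rewrite -(card_in_imset g_inj) subset_leq_card //.
by apply/subsetP=> _ /imsetP[i ih ->]; apply: g_tail.
Qed.

(** Strong induction along the cycle. Either [z i] is colored at the start or it is reached from an
    earlier triangle; [y i] and its outer neighbor are reached from the preceding triangle; then
    [y i] forces [x i]. *)
Lemma cycle_spread C i0 : stalled e C ->
    (forall v, in_diamond v -> exists m, [/\ unit m = unit v, ~~ port m & m \in C]) ->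
    val i0 = 0 -> x i0 \in C -> y i0 \in C -> (forall i, i \in chord_heads -> z i \in C) ->
  forall i, t i \subset C.
Proof.
move=> stC midC i00 xC yC zC i; have [k] := ubnP i; elim: k i => // k IHk i /ltnSE ik.
have tC (j : 'I_n) : j < i -> t j \subset C by move=> ji; apply: IHk; apply: leq_trans ji ik.
have spread (j : 'I_n) u v : j < i -> u \in t j -> connect step u v ->
    (v \in C) && (outmate v \in C).
  move=> ji ut uv; have [tu Uu] := cycle_triangle ut.
  by apply: (triangle_spread stC midC tu _ uv); rewrite Uu tC.
have zt j : z j \in t j by rewrite txyz !inE eqxx !orbT.
have ziC : z i \in C.
  have [ih|] := boolP (i \in chord_heads); first exact: zC.
  rewrite inE => /forallPn[j]; rewrite negb_imply -ltnNge => /andP[zij ji].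
  by have /andP[] := spread j (z j) (z i) ji (zt j) (etrans (step_connect_sym _ _) zij).
apply/subsetP=> v; rewrite txyz !inE.
have [ii0|ii0] := eqVneq i i0.
  by rewrite -ii0 in xC yC; case/or3P=> /eqP->.
have i_gt0 : 0 < i.
  by rewrite lt0n; apply: contraNneq ii0 => iE; apply/eqP/val_inj; rewrite i00.
(* [ord_pred] is cyclic: it decreases the index only because [i] is positive. *)
have pi : ord_pred i < i.
  rewrite /= -subn1 -addnBAC // modnDr modn_small subn1 ?ltn_predL //.
  exact: leq_ltn_trans (leq_pred i) (ltn_ord i).
have yi : (y i \in C) && (outmate (y i) \in C).
  apply: (spread (ord_pred i) (x (ord_pred i))) => //.
    by rewrite txyz !inE eqxx.
  by have := xy_connect (ord_pred i); rewrite ord_predK.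
have /andP[yiC oyC] := yi.
have xiC : x i \in C.
  have [xt yt] : x i \in t i /\ y i \in t i by rewrite !txyz !inE !eqxx orbT.
  have [ty Uy] := cycle_triangle yt.
  have /triangle_unitP[_ adj] : triangle_unit e (t i).
    by move: ty; rewrite /in_triangle Uy inE => /andP[].
  have xy : x i != y i by have := uxyz i; rewrite /= !inE negb_or => /andP[/andP[]].
  apply: (stalled_force stC yiC) => [|w eyw wx]; first by rewrite adj // eq_sym.
  have [Uyw|Uyw] := eqVneq (unit (y i)) (unit w); last first.
    by rewrite -(@outmateE (y i) w) // /outer eyw.
  have: w \in t i by rewrite -Uy mem_unit Uyw.
  by rewrite txyz !inE (negPf wx) /= => /orP[] /eqP->.
by case/or3P=> /eqP->.
Qed.
End Cycle.

(** * Forcing sets *)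

(* The default [x0] is never reached: every diamond has a vertex that is not a
   port. *)
Definition middles (x0 : V) :=
  [set odflt x0 [pick m in D | ~~ port m] | D : {set V} in diamond_units e P].

Lemma middlesP x0 v : in_diamond v ->
  exists m, [/\ unit m = unit v, ~~ port m & m \in middles x0].
Proof.
move=> dv; exists (odflt x0 [pick m in unit v | ~~ port m]).
have m_in : odflt x0 [pick m in unit v | ~~ port m] \in middles x0.
  exact: imset_f.
case: pickP m_in => [m /andP[mv pm]|none] /= m_in.
  by split=> //; apply/esym/eqP; rewrite -mem_unit.
have [a [b [c [d [UE _ _ pb _]]]]] := diamond_vertices dv.
by have := none b; rewrite /= pb UE !inE eqxx !orbT.
Qed.

(* The first unit is colored from one of its ports and the neighbor outside. *)
Lemma necklace_forcing_set : connected_graph e -> triangle_units e P = set0 ->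
  exists2 S, zero_forcing e S & #|S| <= #|diamond_units e P| + 2.
Proof.
move=> conn noT; have [/card_gt0P[v0 _] _] := conn.
have dia v : in_diamond v by rewrite in_diamondE /in_triangle noT inE.
have [a [b [c [d [_ _ ad _ _]]]]] := diamond_vertices (dia v0).
have pa : port a by rewrite port_diamond //; apply/existsP; exists d.
exists (middles v0 :|: [set a; outmate a]); last first.
  apply: leq_trans (leq_card_setU _ _) _.
  by rewrite leq_add ?leq_imset_card // cards2; case: (_ != _).
apply: zero_forcing_stalled => C sC stC.
have midC v : in_diamond v -> exists m, [/\ unit m = unit v, ~~ port m & m \in C].
  move=> /(middlesP v0)[m [Um pm mS]]; exists m; split=> //.
  by rewrite (subsetP sC) // inE mS.
apply: (all_spread stC midC (x := a)) => //.
  by apply: diamond_spread => //; rewrite (subsetP sC) // !inE eqxx !orbT.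
by move=> y ty; have := dia y; rewrite in_diamondE ty.
Qed.

(** The three terms of the size bound count the colored middles, the third ports of the chord heads,
    and the two cycle ports of the first triangle. *)
Lemma hamiltonian_forcing_set : connected_graph e -> hamiltonian MG ->
  exists S h, [/\ zero_forcing e S, #|S| <= #|diamond_units e P| + h + 2
                & h.*2 <= #|triangle_units e P|].
Proof.
move=> conn /hamiltonian_ports[n [t [x [y [z [[n1 t_inj tE] txyz]]]]]].
have n0 : 0 < n by apply: ltnW.
pose i0 := Ordinal n0; pose H := chord_heads z.
have tE' i : t i =i [:: x i; y i; z i] by have [] := txyz i.
have tU i : uniq [:: x i; y i; z i] by have [] := txyz i.
have xy i : connect step (x i) (y (ordS i)) by have [] := txyz i.
exists (middles (x i0) :|: [set z i | i in H] :|: [set x i0; y i0]), #|H|; split.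
- apply: zero_forcing_stalled => C sC stC.
  have midC v : in_diamond v ->
      exists m, [/\ unit m = unit v, ~~ port m & m \in C].
    move=> /(middlesP (x i0))[m [Um pm mS]]; exists m; split=> //.
    by rewrite (subsetP sC) // !inE mS.
  have tC : forall i, t i \subset C.
    apply: (cycle_spread tE tE' tU xy (i0 := i0)) => //.
    - by rewrite (subsetP sC) // !inE eqxx !orbT.
    - by rewrite (subsetP sC) // !inE eqxx !orbT.
    by move=> i iH; rewrite (subsetP sC) // !inE imset_f ?orbT.
  have xt : x i0 \in t i0 by rewrite tE' inE eqxx.
  have Ux : unit (x i0) = t i0 by have [] := cycle_triangle tE xt.
  apply: (all_spread stC midC (x := x i0)) => // [|v]; first by rewrite Ux.
  rewrite /in_triangle tE => /imsetP[i _ Uv].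
  by apply: (subsetP (tC i)); rewrite -Uv mem_unit.
- apply: leq_trans (leq_card_setU _ _) _.
  apply: leq_add; last by rewrite cards2; case: (_ != _).
  apply: leq_trans (leq_card_setU _ _) _.
  by rewrite leq_add ?leq_imset_card.
by rewrite tE card_imset // card_ord; apply: chord_heads_half t_inj tE tE' tU xy.
Qed.

End UnitGraph.

(** * The bound on the zero forcing number *)

Import Order.TTheory GRing.Theory Num.Theory.
Local Open Scope ring_scope.

Theorem lemma2p10 (V : finType) (e : rel V)
    (e_sym : symmetric e) (e_irr : irreflexive e)
    (e_conn : connected_graph e) (e_claw : claw_free e) (e_cubic : cubic e)
    (e_notK4 : ~~ induces e (complete_graph 4) [set: V])
    (P : {set {set V}}) (P_units : unit_partition e P)
    (M_ham : contraction_hamiltonian e P) :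
  (zero_forcing_number e)%:R <=
    (#|triangle_units e P|)%:R / 2%:R + (#|diamond_units e P|)%:R + 2%:R :> rat.
Proof.
(* Both cases give an integer bound in which [h] is at most half the number of triangles; a necklace
   has [h = 0]. *)
have [S [h [S_forces S_card h_half]]] : exists S h,
    [/\ zero_forcing e S, #|S| <= #|diamond_units e P| + h + 2
      & h.*2 <= #|triangle_units e P|]%N.
  case: M_ham => [noT|ham]; last exact: hamiltonian_forcing_set ham.
  have [S Sf Sc] := necklace_forcing_set e_sym e_irr e_cubic P_units e_conn noT.
  by exists S, 0%N; rewrite addn0.
have := leq_trans (zero_forcing_number_le S_forces) S_card.
rewrite -(ler_nat rat) !natrD => Z_le.
move: h_half; rewrite -(ler_nat rat) -muln2 natrM => h_le.
lra.
Qed.
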